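(* Let $\Omega\subset\mathbb{R}^d$ be compact and satisfy an interior cone condition, and let $\mathbb{P}$ be a nicely behaving distribution on $\Omega$. For each $n$ let $X_n=\{x_1,\dots,x_n\}$ be a set of $n$ i.i.d. samples from $\mathbb{P}$, let $h_n$ be the fill distance of $X_n$ with respect to $\Omega$, and let $\delta_n$ be the separation of $X_n$. Then, as $n\to\infty$, $$h_n=O_P\big(n^{-1/d}\,(\ln n)^{1/d}\big)\qquad\text{and}\qquad \delta_n=\Omega_P\big(n^{-2/d}\big).$$
   Context: Interior cone condition: there exist an angle $\vartheta\in(0,\pi/2)$ and a radius $r>0$ such that for every $x\in\Omega$ there is a unit vector $\xi(x)$ for which the cone $\{x+\lambda y: y\in\mathbb{R}^d,\ \|y\|_2=1,\ y^T\xi(x)\ge\cos\vartheta,\ \lambda\in[0,r]\}$ is contained in $\Omega$. Nicely behaving distribution: a probability distribution on $\Omega$ with a density $p$, $p(x)>0$ for all $x\in\Omega$, for which there are constants $0<\underline{c}\le\bar{c}<\infty$ with $\underline{c}\,\mu\le \mathbb{P}\le\bar{c}\,\mu$, where $\mu$ is the uniform probability measure on $\Omega$ (normalized Lebesgue measure); equivalently, $p$ lies between $\underline{c}/\mathrm{Vol}_d(\Omega)$ and $\bar{c}/\mathrm{Vol}_d(\Omega)$. Fill distance: $h_n=\sup_{x\in\Omega}\min_{1\le i\le n}\|x-x_i\|$. Separation: $\delta_n=\min_{1\le i<j\le n}\|x_i-x_j\|$ (for $n\ge2$). $X_n=O_P(a_n)$ means: for every $\varepsilon>0$ there exist finite $M>0$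 and $N>0$ such that $P(|X_n/a_n|>M)<\varepsilon$ for all $n>N$. $Y_n=\Omega_P(b_n)$ means: for every $\varepsilon>0$ there exist finite $m>0$ and $N>0$ such that $P(|Y_n/b_n|<m)<\varepsilon$ for all $n>N$. *)

(* Defs.v *)
From HB Require Import structures.
From mathcomp Require Import all_boot all_order all_algebra.
From mathcomp Require Import all_classical all_reals all_analysis.

Set Implicit Arguments.
Unset Strict Implicit.
Unset Printing Implicit Defensive.

Import Order.TTheory GRing.Theory Num.Theory.
Import numFieldNormedType.Exports.

Local Open Scope classical_set_scope.
Local Open Scope ring_scope.

Definition rV_display : measure_display -> measure_display.
Proof. exact. Qed.

(* The sigma-algebra generated by the coordinates, as for tuples; over a
   realType it is the Borel one, see measurable_rV_borel. *)
Section measurable_rV.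
Context {disp} {T : sigmaRingType disp}.
Variable n : nat.

Definition rV_coord (i : 'I_n) (x : 'rV[T]_n) : T := x ord0 i.

Let rV_set0 : g_sigma_preimage rV_coord set0.
Proof. exact: sigma_algebra0. Qed.

Let rV_setC A : g_sigma_preimage rV_coord A -> g_sigma_preimage rV_coord (~` A).
Proof. exact: sigma_algebraC. Qed.

Let rV_bigcup (F : (set 'rV[T]_n)^nat) :
  (forall i, g_sigma_preimage rV_coord (F i)) ->
  g_sigma_preimage rV_coord (\bigcup_i (F i)).
Proof. exact: sigma_algebra_bigcup. Qed.

HB.instance Definition _ := @isMeasurable.Build (rV_display disp)
  'rV[T]_n (g_sigma_preimage rV_coord) rV_set0 rV_setC rV_bigcup.

End measurable_rV.

Lemma measurable_rV_coord disp (T : measurableType disp) n (i : 'I_n) :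
  measurable_fun [set: 'rV[T]_n] (rV_coord i).
Proof.
move=> _ Y mY; rewrite setTI; apply: sub_sigma_algebra => /=.
rewrite -bigcup_seq/=; exists i => /=; first by rewrite mem_index_enum.
by exists Y => //; rewrite setTI.
Qed.

Lemma measurable_fun_rVP d1 d2 (T1 : measurableType d1) (T2 : measurableType d2)
    n (f : T1 -> 'rV[T2]_n) :
  (forall i, measurable_fun [set: T1] (fun x => f x ord0 i)) ->
  measurable_fun [set: T1] f.
Proof.
move=> mf _ A mA; rewrite setTI.
have : <<s \big[setU/set0]_(i < n)
    preimage_set_system setT (@rV_coord _ T2 n i) measurable >> `<=`
  image_set_system setT f measurable.
  apply: smallest_sub.
    exact/sigma_algebra_image/sigma_algebra_measurable.
  rewrite -bigcup_seq => B [i /= _ [C mC <-]].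
  rewrite /image_set_system /= !setTI.
  by have := mf i measurableT _ mC; rewrite setTI.
by move=> /(_ A mA); rewrite /image_set_system/= setTI.
Qed.

(* The library's sigma-finite instance on product measures is not inferred
   outside of its section. *)
Lemma product_sigma_finite d1 d2 (T1 : measurableType d1)
    (T2 : measurableType d2) (R : realType)
    (m1 : {sigma_finite_measure set T1 -> \bar R})
    (m2 : {sigma_finite_measure set T2 -> \bar R}) :
  sigma_finite [set: T1 * T2] (m1 \x m2)%E.
Proof.
have /sigma_finiteP[F [TF ndF Foo]] := sigma_finiteT m1.
have /sigma_finiteP[G [TG ndG Goo]] := sigma_finiteT m2.
exists (fun n => F n `*` G n).
  rewrite -setXTT TF TG predeqE => -[x y]; split.
    move=> [/= [n _ Fnx] [k _ Gky]]; exists (maxn n k) => //; split.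
    - by move: x Fnx; exact/subsetPset/ndF/leq_maxl.
    - by move: y Gky; exact/subsetPset/ndG/leq_maxr.
  by move=> [n _ []/= ? ?]; split; exists n.
move=> k; have [? ?] := Foo k; have [? ?] := Goo k.
split; first exact: measurableX.
by rewrite product_measure1E// lte_mul_pinfty// ge0_fin_numE.
Qed.

(* lebesgue_rV n is the n-fold product of the one-dimensional Lebesgue measure.
   That measure lives on measurableTypeR R rather than on R itself; the two
   types are convertible and carry the same sigma-algebra, under different
   displays. *)
Section lebesgue_rV.
Context {R : realType}.
Local Notation RT := (measurableTypeR R).

Definition rV_cons n (p : RT * 'rV[R]_n) : 'rV[R]_n.+1 :=
  \row_i oapp (p.2 ord0) p.1 (unlift ord0 i).

Definition rV_uncons n (x : 'rV[R]_n.+1) : RT * 'rV[R]_n :=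
  (x ord0 ord0, \row_i x ord0 (lift ord0 i)).

Lemma rV_cons0 n (p : RT * 'rV[R]_n) : rV_cons p ord0 ord0 = p.1.
Proof. by rewrite mxE unlift_none. Qed.

Lemma rV_consS n (p : RT * 'rV[R]_n) i :
  rV_cons p ord0 (lift ord0 i) = p.2 ord0 i.
Proof. by rewrite mxE liftK. Qed.

Lemma rV_consK n : cancel (@rV_cons n) (@rV_uncons n).
Proof.
move=> [x y]; rewrite /rV_uncons rV_cons0; congr pair.
by apply/rowP => i; rewrite mxE rV_consS.
Qed.

Lemma measurable_rV_cons n : measurable_fun [set: RT * 'rV[R]_n] (@rV_cons n).
Proof.
apply: measurable_fun_rVP => i; case: (unliftP ord0 i) => [j ->|->].
  under eq_fun do rewrite rV_consS.
  exact: (measurableT_comp (@measurable_rV_coord _ R n j) measurable_snd).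
by under eq_fun do rewrite rV_cons0; exact: measurable_fst.
Qed.

Lemma measurable_rV_uncons n : measurable_fun [set: 'rV[R]_n.+1] (@rV_uncons n).
Proof.
apply/measurable_fun_pair; first exact: (@measurable_rV_coord _ R _ ord0).
apply: measurable_fun_rVP => i.
under eq_fun do rewrite mxE.
exact: (@measurable_rV_coord _ R _ (lift ord0 i)).
Qed.

Section step.
Variables (n : nat) (mu : {sigma_finite_measure set 'rV[R]_n -> \bar R}).
Local Open Scope ereal_scope.

Definition lebesgue_rV_step : set 'rV[R]_n.+1 -> \bar R :=
  pushforward (lebesgue_measure \x mu) (@rV_cons n).

Let step0 : lebesgue_rV_step set0 = 0.
Proof. by rewrite /lebesgue_rV_step /pushforward preimage_set0 measure0. Qed.

Let step_ge0 A : 0 <= lebesgue_rV_step A.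
Proof. by rewrite /lebesgue_rV_step /pushforward; exact: measure_ge0. Qed.

Let step_sigma_additive : semi_sigma_additive lebesgue_rV_step.
Proof.
move=> F mF tF mUF; rewrite /lebesgue_rV_step /pushforward preimage_bigcup.
apply: measure_semi_sigma_additive.
- by move=> k; rewrite -[X in measurable X]setTI; exact: measurable_rV_cons.
- apply/trivIsetP => /= i j _ _ ij; rewrite -preimage_setI.
  by move/trivIsetP : tF => /(_ _ _ _ _ ij) ->//; rewrite preimage_set0.
- rewrite -preimage_bigcup -[X in measurable X]setTI.
  exact: measurable_rV_cons.
Qed.

HB.instance Definition _ := isMeasure.Build _ _ _
  lebesgue_rV_step step0 step_ge0 step_sigma_additive.

Let step_sigma_finite : sigma_finite [set: 'rV[R]_n.+1] lebesgue_rV_step.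
Proof.
have [F FT mF] : sigma_finite [set: RT * 'rV[R]_n] (lebesgue_measure \x mu).
  exact: product_sigma_finite.
exists (fun k => @rV_uncons n @^-1` F k).
  by rewrite -preimage_bigcup -FT preimage_setT.
move=> k; have [mFk Fkoo] := mF k; split.
  by rewrite -[X in measurable X]setTI; exact: measurable_rV_uncons.
rewrite /lebesgue_rV_step /pushforward -comp_preimage.
rewrite (_ : _ \o _ = id) ?preimage_id//.
by apply/funext => p; exact: rV_consK.
Qed.

HB.instance Definition _ := Measure_isSigmaFinite.Build _ _ _
  lebesgue_rV_step step_sigma_finite.

End step.

Fixpoint lebesgue_rV n : {sigma_finite_measure set 'rV[R]_n -> \bar R} :=
  match n with
  | 0 => \d_(0 : 'rV[R]_0)
  | n'.+1 => lebesgue_rV_step (lebesgue_rV n')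
  end.

Lemma measurable_rV_forall n (A : 'I_n -> set R) :
  (forall i, measurable (A i)) ->
  measurable [set x : 'rV[R]_n | forall i, A i (x ord0 i)].
Proof.
move=> mA.
rewrite [X in measurable X](_ : _ = \big[setI/setT]_(i < n) (rV_coord i @^-1` A i)).
  apply: bigsetI_measurable => i _; rewrite -[X in measurable X]setTI.
  exact: (@measurable_rV_coord _ R).
rewrite -bigcap_seq; apply/seteqP; split => x /= xA i; first by move=> _; exact: xA.
by apply: (xA i); rewrite /= mem_index_enum.
Qed.

Lemma measurable_rV_borel n : @measurable _ 'rV[R]_n = <<s @open 'rV[R]_n >>.
Proof.
apply/seteqP; split.
  apply: smallest_sub; first exact: smallest_sigma_algebra.
  rewrite -bigcup_seq => B [i /= _ [C mC <-]]; rewrite setTI.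
  have : <<s @open R >> `<=` image_set_system setT (@rV_coord _ R n i) <<s @open 'rV[R]_n >>.
    apply: smallest_sub; first exact/sigma_algebra_image/smallest_sigma_algebra.
    move=> U oU; rewrite /image_set_system /= setTI; apply: sub_sigma_algebra.
    by move/continuousP : (@coord_continuous R 1 n ord0 i); exact.
  move=> /(_ C); rewrite /image_set_system/= setTI; apply.
  move: mC; rewrite [_ C](congr1 (@^~ C) (measurable_realfun.RGenOpens.measurableE R)).
  apply: smallest_sub; first exact: smallest_sigma_algebra.
  by move=> _ [a [b ->]]; apply: sub_sigma_algebra; exact: interval_open.
apply: smallest_sub; first exact: sigma_algebra_measurable.
move=> U oU.
pose D := [set qk : 'rV[rat]_n * nat |
  ball (map_mx ratr qk.1 : 'rV[R]_n) qk.2.+1%:R^-1 `<=` U].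
rewrite (_ : U = \bigcup_(qk in D)
    ball (map_mx ratr qk.1 : 'rV[R]_n) qk.2.+1%:R^-1).
  rewrite bigcup_mkcond; apply: countable_bigcupT_measurable => // -[q k] /=.
  case: ifPn => // _.
  rewrite [X in measurable X](_ : _ = [set x : 'rV[R]_n | forall i,
      ball (ratr (q ord0 i) : R) k.+1%:R^-1 (x ord0 i)]).
    apply: (@measurable_rV_forall _
      (fun i => ball (ratr (q ord0 i) : R) k.+1%:R^-1)) => i.
    apply: measurable_realfun.open_measurable; apply: ball_open; rewrite invr_gt0 ltr0n.
  apply/seteqP; split => x /=.
    by move=> [_ qx] i; have := qx ord0 i; rewrite mxE.
  by move=> qx; split => // i j; rewrite ord1 mxE.
apply/seteqP; split => [x Ux|x [qk Dqk /Dqk//]].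
have /nbhs_ballP[e /= e0 exU] : nbhs x U by exact: open_nbhs_nbhs.
pose k := Num.truncn (2 / e).
have ke : k.+1%:R^-1 <= e / 2.
  rewrite -[leRHS]invrK lef_pV2 ?posrE ?invr_gt0 ?divr_gt0//.
  by rewrite invf_div ltW// truncnS_gt.
have kx i : {q : rat | ratr q \in `]x ord0 i - k.+1%:R^-1, x ord0 i + k.+1%:R^-1[}.
  by apply/cid/rat_in_itvoo; rewrite ltrBlDr -addrA ltrDl addr_gt0.
pose q : 'rV[rat]_n := \row_i sval (kx i).
have qx : ball (map_mx ratr q : 'rV[R]_n) k.+1%:R^-1 x.
  split => // i j; rewrite ord1 !mxE; have := svalP (kx j).
  by rewrite /ball/= in_itv/= ltr_distl; case: (kx j).
exists (q, k) => //= y qy; apply: exU; rewrite [e]splitr.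
by apply: (@ball_triangle _ _ (map_mx ratr q : 'rV[R]_n));
  [apply: ball_sym|]; exact: le_ball ke _ _.
Qed.

Lemma lebesgue_rV_box n (a b : 'rV[R]_n) :
    (forall i, a ord0 i <= b ord0 i) ->
  lebesgue_rV n [set x | forall i, a ord0 i <= x ord0 i <= b ord0 i] =
  (\prod_(i < n) (b ord0 i - a ord0 i))%:E.
Proof.
elim: n a b => [|n IHn] a b ab.
  by rewrite big_ord0 /= diracE mem_set// => -[].
pose a' := (rV_uncons a).2; pose b' := (rV_uncons b).2.
have ab' i : a' ord0 i <= b' ord0 i by rewrite !mxE.
rewrite big_ord_recl /= /lebesgue_rV_step /pushforward.
transitivity ((lebesgue_measure \x lebesgue_rV n)%E
    (([set` `[a ord0 ord0, b ord0 ord0]] : set RT) `*`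
     [set x : 'rV[R]_n | forall i, a' ord0 i <= x ord0 i <= b' ord0 i])).
  congr (_ _); apply/seteqP; split => -[x y] /=.
    move=> xy; split; first by have := xy ord0; rewrite rV_cons0 in_itv.
    by move=> i; have := xy (lift ord0 i); rewrite rV_consS !mxE.
  rewrite in_itv/= => -[abx aby] i; case: (unliftP ord0 i) => [j ->|->].
    by rewrite rV_consS; have := aby j; rewrite !mxE.
  by rewrite rV_cons0.
rewrite product_measure1E//; last first.
  apply: (@measurable_rV_forall _ (fun i => `[a' ord0 i, b' ord0 i]%classic)).
  by move=> i; exact: measurable_itv.
rewrite IHn// [X in (X * _)%E](lebesgue_measure_itv `[a ord0 ord0, b ord0 ord0]).
rewrite /= lte_fin EFinM.
have -> : \prod_(i < n) (b ord0 (lift ord0 i) - a ord0 (lift ord0 i)) =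
    \prod_(i < n) (b' ord0 i - a' ord0 i).
  by apply: eq_bigr => i _; rewrite !mxE.
have := ab ord0; rewrite le_eqVlt => /orP[/eqP ->|->]; last by rewrite EFinD.
by rewrite ltxx subrr !mul0e.
Qed.

End lebesgue_rV.

Section geometry.
Context {R : realType} {d : nat}.
Implicit Types (x y xi : 'rV[R]_d) (Omega : set 'rV[R]_d).

Definition dotp x y : R := \sum_(i < d) x ord0 i * y ord0 i.

(* The norm `|x| that the library puts on 'rV[R]_d is the sup norm. *)
Definition l2norm x : R := Num.sqrt (\sum_(i < d) x ord0 i ^+ 2).

Definition cone x xi (theta r : R) : set 'rV[R]_d :=
  [set z | exists y (lambda : R), [/\ l2norm y = 1, cos theta <= dotp y xi,
     0 <= lambda <= r & z = x + lambda *: y]].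

Definition interior_cone_condition Omega : Prop :=
  exists theta r : R, [/\ 0 < theta < pi / 2, 0 < r &
    forall x, Omega x -> exists2 xi, l2norm xi = 1 & cone x xi theta r `<=` Omega].

(* Both minima are taken in \bar R with unit +oo, so that they are minima of
   nonempty finite families as soon as n >= 1, resp. n >= 2. *)
Definition fill_distance Omega n (X : 'I_n -> 'rV[R]_d) : R :=
  sup [set fine (\big[mine/+oo%E]_(i < n) (l2norm (x - X i))%:E) | x in Omega].

Definition separation n (X : 'I_n -> 'rV[R]_d) : R :=
  fine (\big[mine/+oo%E]_(p : 'I_n * 'I_n | (p.1 < p.2)%N)
    (l2norm (X p.1 - X p.2))%:E).

End geometry.

Section distributions.
Context {R : realType} {d : nat}.
Implicit Types (Omega : set 'rV[R]_d) (Q : probability 'rV[R]_d R).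
Local Open Scope ereal_scope.

Definition uniform_on Omega (A : set 'rV[R]_d) : \bar R :=
  ((fine (lebesgue_rV d Omega))^-1)%:E * lebesgue_rV d (A `&` Omega).

Definition has_positive_density Omega Q : Prop :=
  exists p : 'rV[R]_d -> R,
    [/\ measurable_fun Omega p, (forall x, Omega x -> (0 < p x)%R) &
      forall A, measurable A -> A `<=` Omega ->
        Q A = \int[lebesgue_rV d]_(x in A) (p x)%:E].

Definition nicely_behaving Omega Q : Prop :=
  [/\ Q Omega = 1, has_positive_density Omega Q &
    exists c C : R, (0 < c <= C)%R /\
      forall A, measurable A ->
        c%:E * uniform_on Omega A <= Q A <= C%:E * uniform_on Omega A].

End distributions.

Section probability.
Context {R : realType} {disp : measure_display} {T : measurableType disp}.
Variable P : probability T R.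

Definition mutually_independent disp' (U : measurableType disp') n
    (X : 'I_n -> {RV P >-> U}) : Prop :=
  forall (J : {set 'I_n}) (A : 'I_n -> set U),
    (forall i, i \in J -> measurable (A i)) ->
    P (\bigcap_(i in [set` J]) (X i @^-1` A i)) =
    (\prod_(i in J) P (X i @^-1` A i))%E.

Definition iid_sample disp' (U : measurableType disp') (Q : probability U R) n
    (X : 'I_n -> {RV P >-> U}) : Prop :=
  mutually_independent X /\
  forall i A, measurable A -> distribution P (X i) A = Q A.

Definition bigO_P (Z : nat -> T -> R) (a : nat -> R) : Prop :=
  forall e : R, 0 < e -> exists (M : R) (N : nat), [/\ 0 < M, (0 < N)%N &
    forall n, (N < n)%N -> (P [set w | (`|Z n w / a n| > M)%R] < e%:E)%E].

Definition bigOmega_P (Z : nat -> T -> R) (b : nat -> R) : Prop :=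
  forall e : R, 0 < e -> exists (m : R) (N : nat), [/\ 0 < m, (0 < N)%N &
    forall n, (N < n)%N -> (P [set w | (`|Z n w / b n| < m)%R] < e%:E)%E].

End probability.

(* Main.v *)
(** A small cube of side proportional to [rho] inside the cone at [x] gives
    [c * rho ^ d <= Q (ball x rho)] for all [x] in [Omega] and small [rho].
    Cut a cube containing [Omega] into O(rho ^ -d) cells of diameter at most
    [rho].  If the fill distance exceeds [2 * rho], some cell meeting [Omega]
    has a representative whose [rho]-ball is missed by all [n] samples, which
    has probability at most [exp (- n * c * rho ^ d)]; a union bound with
    [c * rho ^ d = 2 * ln n / n] concludes.  For the separation, two samples at
    distance less than [s] lie in a cell of side at most [s] and in its
    enlargement of side at most [3 * s], so the same grid bounds the probability
    for one pair by O(s ^ d) using independence only through product events;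
    then sum over the at most [n ^ 2] pairs. *)

Require Import Defs.
From HB Require Import structures.
From mathcomp Require Import all_boot all_order all_algebra.
From mathcomp Require Import all_classical all_reals all_analysis.
From mathcomp Require Import ring lra.

Import Order.TTheory GRing.Theory Num.Theory.
Import numFieldNormedType.Exports.

Set Implicit Arguments.
Unset Strict Implicit.
Unset Printing Implicit Defensive.

Local Open Scope classical_set_scope.
Local Open Scope ring_scope.

(** * Euclidean norm: Cauchy-Schwarz, triangle inequality, comparison with the sup norm *)

Section l2norm.
Context {R : realType} {d : nat}.
Implicit Types (x y : 'rV[R]_d) (Omega : set 'rV[R]_d).

Lemma dotpxx x : dotp x x = l2norm x ^+ 2.
Proof.
rewrite sqr_sqrtr; last by apply: sumr_ge0 => i _; exact: sqr_ge0.
by apply: eq_bigr => i _; rewrite expr2.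
Qed.

Lemma dotpDl x y z : dotp (x + y) z = dotp x z + dotp y z.
Proof. by rewrite -big_split; apply: eq_bigr => i _; rewrite mxE mulrDl. Qed.

Lemma dotpZl a x y : dotp (a *: x) y = a * dotp x y.
Proof. by rewrite mulr_sumr; apply: eq_bigr => i _; rewrite mxE mulrA. Qed.

Lemma dotpC x y : dotp x y = dotp y x.
Proof. by apply: eq_bigr => i _; rewrite mulrC. Qed.

Lemma l2norm_ge0 x : 0 <= l2norm x.
Proof. exact: sqrtr_ge0. Qed.

Lemma normr_coord_le_l2norm x i : `|x ord0 i| <= l2norm x.
Proof.
rewrite -sqrtr_sqr ler_wsqrtr// (bigD1 i)//= lerDl.
by apply: sumr_ge0 => j _; exact: sqr_ge0.
Qed.

Lemma l2norm_eq0 x : l2norm x = 0 -> x = 0.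
Proof.
move=> x0; apply/rowP => i; rewrite mxE; apply/eqP; rewrite -normr_eq0.
by rewrite eq_le normr_ge0 -x0 normr_coord_le_l2norm.
Qed.

Lemma l2normZ a x : l2norm (a *: x) = `|a| * l2norm x.
Proof.
rewrite -sqrtr_sqr -sqrtrM ?sqr_ge0// mulr_sumr; congr Num.sqrt.
by apply: eq_bigr => i _; rewrite mxE exprMn.
Qed.

Lemma l2norm_distC x y : l2norm (x - y) = l2norm (y - x).
Proof. by rewrite -opprB -scaleN1r l2normZ normrN1 mul1r. Qed.

(** Cauchy-Schwarz without division: the squared norm of |y|^2 x - <x,y> y equals |y|^2 (|x|^2 |y|^2
    - <x,y>^2), and the factor |y|^2 cancels once [y] is nonzero. *)
Lemma dotp_le x y : `|dotp x y| <= l2norm x * l2norm y.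
Proof.
have [y0|y0] := eqVneq (l2norm y) 0.
  rewrite y0 mulr0 (l2norm_eq0 y0) dotpC (_ : dotp _ _ = 0) ?normr0//.
  by rewrite /dotp big1// => i _; rewrite mxE mul0r.
have ygt0 : 0 < l2norm y ^+ 2 by rewrite exprn_gt0// lt0r y0 l2norm_ge0.
rewrite -(@ler_pXn2r _ 2)// ?nnegrE ?mulr_ge0 ?l2norm_ge0//.
rewrite exprMn real_normK ?num_real//.
have : 0 <= dotp (l2norm y ^+ 2 *: x + (- dotp x y) *: y)
                 (l2norm y ^+ 2 *: x + (- dotp x y) *: y).
  by rewrite dotpxx sqr_ge0.
rewrite !(dotpDl, dotpZl) !(dotpC _ (_ + _)) !(dotpDl, dotpZl) !dotpxx.
rewrite (dotpC y x) => h.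
rewrite -subr_ge0 -(pmulr_rge0 _ ygt0); apply: le_trans h _.
by rewrite le_eqVlt; apply/orP; left; apply/eqP; ring.
Qed.

Lemma l2norm_triangle x y : l2norm (x + y) <= l2norm x + l2norm y.
Proof.
rewrite -(@ler_pXn2r _ 2)// ?nnegrE ?addr_ge0 ?l2norm_ge0//.
rewrite -dotpxx dotpDl !(dotpC _ (_ + _)) !dotpDl !dotpxx (dotpC y x).
have := le_trans (ler_norm _) (dotp_le x y); lra.
Qed.

Lemma l2norm_le_sup x s : (forall i, `|x ord0 i| <= s) -> l2norm x <= d%:R * s.
Proof.
(* For [d = 0] the bound [xs] says nothing about the sign of [s], but both sides then vanish. *)
move=> xs; have [d0|/card_gt0P[i _]] := posnP #|'I_d|.
  rewrite /l2norm big1 ?sqrtr0; last by move=> i; case: (card0_eq d0 i).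
  by rewrite card_ord in d0; rewrite d0 mul0r.
have s0 : 0 <= s := le_trans (normr_ge0 _) (xs i).
rewrite -(@ler_pXn2r _ 2)// ?nnegrE ?mulr_ge0 ?l2norm_ge0// -dotpxx.
apply: (@le_trans _ _ (\sum_(j < d) s ^+ 2)).
  apply: ler_sum => j _; rewrite -expr2 -real_normK ?num_real//.
  by rewrite lerXn2r ?nnegrE.
rewrite sumr_const card_ord exprMn -[leLHS]mulr_natl ler_wpM2r ?sqr_ge0// -natrX.
by rewrite ler_nat; case: d => // k; rewrite leq_pmulr.
Qed.

End l2norm.

Lemma measurable_fun_l2norm_sub (R : realType) (d : nat) (disp : measure_display)
    (T : measurableType disp) (f g : T -> 'rV[R]_d) :
  measurable_fun [set: T] f -> measurable_fun [set: T] g ->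
  measurable_fun [set: T] (fun w => l2norm (f w - g w)).
Proof.
move=> mf mg; apply: (@measurableT_comp _ _ _ _ _ _ (@Num.sqrt R)).
  apply: measurable_realfun.continuous_measurable_fun; exact: sqrt_continuous.
apply: measurable_sum => i; apply: measurable_realfun.measurable_funX.
rewrite (_ : (fun w => _) =
    (fun w => f w ord0 i) \- (fun w => g w ord0 i)); last first.
  by apply/funext => w; rewrite !mxE.
by apply: measurable_realfun.measurable_funB;
  apply: (measurableT_comp (@measurable_rV_coord _ R d i)).
Qed.

(** * Cubes, grids, and a cube inside each cone *)

Section cube.
Context {R : realType} {d : nat}.
Implicit Types (x y c : 'rV[R]_d) (s : R).

Definition cube c s : set 'rV[R]_d :=
  [set y | forall i, `|y ord0 i - c ord0 i| <= s].

Lemma cubeE c s : cube c s =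
  [set y | forall i, (c - const_mx s) ord0 i <= y ord0 i <=
                     (c + const_mx s) ord0 i].
Proof.
by apply/seteqP; split => y /= cy i; have := cy i; rewrite !mxE ler_distl.
Qed.

Lemma measurable_cube c s : measurable (cube c s).
Proof.
apply: (@measurable_rV_forall R d (fun i => [set t | `|t - c ord0 i| <= s])) => i.
rewrite [X in measurable X](_ : _ = `[c ord0 i - s, c ord0 i + s]%classic).
  exact: measurable_itv.
by apply/seteqP; split => t /=; rewrite in_itv /= ler_distl.
Qed.

Lemma lebesgue_cube c s : 0 <= s ->
  lebesgue_rV d (cube c s) = ((2 * s) ^+ d)%:E.
Proof.
move=> s0; rewrite cubeE lebesgue_rV_box; last by move=> i; rewrite !mxE; lra.
congr EFin; rewrite -[in RHS](card_ord d) -prodr_const.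
by apply: eq_bigr => i _; rewrite !mxE; lra.
Qed.

Lemma cube_l2norm c s x y : cube c s x -> cube c s y ->
  l2norm (x - y) <= d%:R * (2 * s).
Proof.
move=> cx cy; apply: l2norm_le_sup => i; rewrite !mxE.
have := cx i; have := cy i; rewrite !ler_norml; lra.
Qed.

(* The centres of the m ^ d equal cells, of half-side B / m, that tile
   [-B, B] ^ d. *)
Definition grid (B : R) m (f : {ffun 'I_d -> 'I_m}) : 'rV[R]_d :=
  \row_i (B * ((2 * f i + 1)%:R / m%:R - 1)).

(** An affine change of variable sends [-B, B] to [0, m] and the cells to unit intervals, so the
    index is the integer part of the image [u]. *)
Lemma grid_cover1 (B : R) m (t : R) : (0 < m)%N -> `|t| <= B ->
  exists k : 'I_m, `|t - B * ((2 * k + 1)%:R / m%:R - 1)| <= B / m%:R.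
Proof.
case: m => // m _ tB; have m0 : (0 : R) < m.+1%:R by rewrite ltr0n.
have : 0 <= B by exact: le_trans tB.
rewrite le_eqVlt => /orP[/eqP B0|B0].
  by exists ord0; move: tB; rewrite -B0 !mul0r subr0.
pose u := (t + B) / (2 * B) * m.+1%:R.
have tE : t = B * (2 * u / m.+1%:R - 1) by rewrite /u; field; lra.
move: tB; rewrite ler_norml => /andP[tB1 tB2].
have u0 : 0 <= u by rewrite mulr_ge0// divr_ge0; lra.
have um : u <= m.+1%:R.
  by rewrite /u ler_piMl ?ler_pdivrMr ?(ltW m0)//; lra.
suff [k ku] : exists k : 'I_m.+1, k%:R <= u <= k.+1%:R.
  exists k; rewrite {1}tE.
  rewrite (_ : _ - _ = B / m.+1%:R * (2 * u - (2 * k + 1)%:R)); last first.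
    by field; lra.
  rewrite normrM gtr0_norm ?divr_gt0// ler_piMr ?divr_ge0 ?(ltW B0) ?(ltW m0)//.
  move: ku; rewrite -natr1 natrD natrM ler_norml => /andP[]; lra.
(* At the right endpoint the integer part is out of range, and the last cell is taken instead. *)
have [um'|um'] := ltP u m.+1%:R.
  have km : (Num.truncn u < m.+1)%N.
    by rewrite -(ltr_nat R); apply: le_lt_trans um'; rewrite truncn_le.
  by exists (Ordinal km) => /=; rewrite truncn_le u0 ltW// truncnS_gt.
by exists ord_max => /=; rewrite um andbT (le_trans _ um')// ler_nat.
Qed.

Lemma grid_cover (B : R) m x : (0 < m)%N -> (forall i, `|x ord0 i| <= B) ->
  exists f : {ffun 'I_d -> 'I_m}, cube (grid B f) (B / m%:R) x.
Proof.
move=> m0 xB; have [f fP] := choice (fun i => grid_cover1 m0 (xB i)).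
by exists [ffun i => f i] => i; rewrite mxE ffunE.
Qed.

(** The cube is centred on the axis of the cone, at distance [p = rho / 2] from [x]. The offset of a
    point of it from [x] is [w = p *: xi + v] with |v| <= k p, hence |w| <= (1 + k) p and <w,xi> >=
    (1 - k) p. The point lies in the cone as soon as c (1 + k) <= 1 - k, where c is the cosine of
    the angle. *)
Lemma interior_cone_cube (Omega : set 'rV[R]_d) : (0 < d)%N ->
  interior_cone_condition Omega ->
  exists k r : R, [/\ 0 < k, 0 < r &
    forall x rho, Omega x -> 0 < rho <= r -> exists z,
      cube z (k * rho) `<=` Omega `&` [set y | l2norm (x - y) <= rho]].
Proof.
move=> d0 [theta [r [/andP[th0 thpi] r0 Ocone]]].
have dgt0 : (0 : R) < d%:R by rewrite ltr0n.
have c0 : 0 < cos theta.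
  by apply: cos_gt0_pihalf; rewrite thpi andbT (lt_trans _ th0)// oppr_lt0 divr_gt0// pi_gt0.
have c1 : cos theta < 1.
  have pi0 := @pi_gt0 R.
  by rewrite -cos0 ltr_cos ?in_itv/=; lra.
(* With this [k] the inequality c (1 + k) <= 1 - k amounts to (1 - c)^2 >= 0; moreover k < 1, which
   keeps [w] nonzero and its norm at most [rho]. *)
set c := cos theta in c0 c1; pose k := (1 - c) / 2.
have k0 : 0 < k by rewrite /k; lra.
exists (k / (2 * d%:R)), r; split => //; first by rewrite divr_gt0// mulr_gt0.
move=> x rho Ox /andP[rho0 rhor]; have [xi xi1 xiO] := Ocone x Ox.
pose p := rho / 2; have p0 : 0 < p by rewrite divr_gt0.
exists (x + p *: xi) => y yz; pose w := y - x; pose v := w - p *: xi.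
have vp : l2norm v <= k * p.
  rewrite (_ : k * p = d%:R * (k / (2 * d%:R) * rho)); last by rewrite /p; field; lra.
  apply: l2norm_le_sup => i; have := yz i; rewrite !mxE.
  by apply: le_trans; rewrite le_eqVlt; apply/orP; left; apply/eqP; congr `|_|; ring.
have wE : w = p *: xi + v by rewrite addrC subrK.
have pxi : l2norm (p *: xi) = p by rewrite l2normZ xi1 mulr1 gtr0_norm.
have w_le : l2norm w <= (1 + k) * p.
  by rewrite wE (le_trans (l2norm_triangle _ _))// pxi mulrDl mul1r lerD2l.
have vxi : - (k * p) <= dotp v xi.
  have := dotp_le v xi; rewrite xi1 mulr1 => /le_trans/(_ vp).
  by rewrite ler_norml => /andP[].
have cw : c * l2norm w <= dotp w xi.
  rewrite wE dotpDl dotpZl dotpxx xi1 expr1n mulr1 -wE.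
  apply: (@le_trans _ _ (c * ((1 + k) * p))); first by rewrite ler_wpM2l// ltW.
  rewrite (@le_trans _ _ ((1 - k) * p))//; last by lra.
  rewrite mulrA ler_wpM2r ?(ltW p0)//.
  have := sqr_ge0 (1 - c); rewrite /k; lra.
(* The direction demanded by [cone] is [w] normalized, so [w] must not vanish. *)
have w0 : 0 < l2norm w.
  have : p - k * p <= dotp w xi.
    by rewrite wE dotpDl dotpZl dotpxx xi1 expr1n mulr1 lerD2l.
  have := le_trans (ler_norm _) (dotp_le w xi); rewrite xi1 mulr1 => h1 h2.
  apply: lt_le_trans (le_trans h2 h1).
  rewrite -{1}[p]mul1r -mulrBl mulr_gt0//; rewrite /k; lra.
have w_rho : l2norm w <= rho.
  rewrite (le_trans w_le)// /p mulrCA ger_pMr// /k; lra.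
split; last by rewrite /= l2norm_distC.
apply: xiO; exists ((l2norm w)^-1 *: w), (l2norm w); split.
- by rewrite l2normZ gtr0_norm ?invr_gt0// mulVf// gt_eqF.
- by rewrite dotpZl mulrC ler_pdivlMr.
- by rewrite (ltW w0) (le_trans w_rho).
- by rewrite scalerA divff ?gt_eqF// scale1r addrC subrK.
Qed.

End cube.

(** * Boundedness of the domain and comparison of [Q] with Lebesgue measure *)

Section nicely_behaving.
Context {R : realType} {d : nat}.
Implicit Types (Omega A : set 'rV[R]_d) (Q : probability 'rV[R]_d R).
Local Open Scope ereal_scope.

Lemma compact_measurable_rV Omega : compact Omega -> measurable Omega.
Proof.
move=> cO; have {}cO : closed Omega.
  by apply: compact_closed cO; exact: norm_hausdorff.
rewrite -(setCK Omega); apply: measurableC; rewrite measurable_rV_borel.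
by apply: sub_sigma_algebra; exact: closed_openC.
Qed.

Lemma compact_coord_bounded Omega : compact Omega ->
  exists2 B : R, (0 < B)%R & forall x i, Omega x -> (`|x ord0 i| <= B)%R.
Proof.
move=> /compact_bounded[M [_ Mbd]]; exists (Num.max 0 M + 1)%R.
  by rewrite ltr_pwDr// le_max lexx.
move=> x i Ox; apply: le_trans (Mbd (Num.max 0 M + 1)%R _ x Ox).
  rewrite [leRHS]mx_normrE.
  exact: (le_bigmax _ (fun ij => `|x ij.1 ij.2|%R) (ord0, i)).
by rewrite (@le_lt_trans _ _ (Num.max 0 M))%R ?le_max ?lexx ?orbT// ltrDl.
Qed.

Lemma nicely_behaving_lebesgue Omega Q : measurable Omega ->
  nicely_behaving Omega Q ->
  exists K K' : R, [/\ (0 < K)%R, (0 < K')%R,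
    (forall A, measurable A -> A `<=` Omega -> K%:E * lebesgue_rV d A <= Q A) &
    (forall A, measurable A -> Q A <= K'%:E * lebesgue_rV d A)].
Proof.
move=> mO [QO _ [c [C [/andP[c0 cC] cQC]]]].
set V := (fine (lebesgue_rV d Omega))^-1%R.
have C0 : (0 < C)%R by exact: lt_le_trans cC.
have V0 : (0 < V)%R.
  (* As [fine] sends [+oo] to 0 and the inverse of 0 is 0, [V = 0] covers both null and infinite
     volume; either would force [Q Omega <= 0]. *)
  rewrite lt0r invr_ge0 fine_ge0 ?measure_ge0// andbT; apply/eqP => V0.
  have /andP[_] := cQC _ mO; rewrite QO /uniform_on -/V V0 mul0e mule0.
  by rewrite lee_fin ler10.
exists (c * V)%R, (C * V)%R; split; [by rewrite mulr_gt0..| |] => A mA.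
  move=> AO; have /andP[+ _] := cQC _ mA; apply: le_trans.
  by rewrite /uniform_on -/V muleA -EFinM setIidl.
have /andP[_ /le_trans] := cQC _ mA; apply.
rewrite /uniform_on -/V muleA -EFinM lee_wpmul2l ?lee_fin ?mulr_ge0 ?(ltW C0) ?(ltW V0)//.
by apply: le_measure; rewrite ?inE//; exact: measurableI.
Qed.

End nicely_behaving.

(** * Union bound and consequences of independence *)

Section union_bound.
Context {disp : measure_display} {T : measurableType disp} {R : realType}.
Variable P : probability T R.
Local Open Scope ereal_scope.

Lemma finite_union_bound (I : finType) (E : set T) (A : I -> set T) (b : R) :
  measurable E -> (forall i, measurable (A i)) ->
  E `<=` \bigcup_i A i -> (forall i, P (A i) <= b%:E) ->
  P E <= (#|I|%:R * b)%:E.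
Proof.
move=> mE mA EA Ab.
have mU s : measurable (\big[setU/set0]_(i <- s) A i).
  by apply: bigsetU_measurable => i _; exact: mA.
have EU : E `<=` \big[setU/set0]_(i <- enum I) A i.
  move=> w /EA[i _ Aiw]; rewrite -bigcup_seq; exists i => //=.
  by rewrite mem_enum.
apply: (@le_trans _ _ (P (\big[setU/set0]_(i <- enum I) A i))).
  by apply: le_measure; rewrite ?inE.
rewrite cardE; elim: (enum I) => [|i s IH].
  by rewrite big_nil measure0 mul0r.
rewrite big_cons /= -natr1 mulrDl mul1r addrC EFinD.
by apply: le_trans (leeD (Ab i) IH); exact: measureU2.
Qed.

(** The product formula is applied to the index set {i, j}, with the family equal to [C] at [i] and
    to [D] elsewhere. *)
Lemma mutually_independent2 disp' (U : measurableType disp') n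
    (X : 'I_n -> {RV P >-> U}) i j (C D : set U) :
  mutually_independent X -> i != j -> measurable C -> measurable D ->
  P (X i @^-1` C `&` X j @^-1` D) = P (X i @^-1` C) * P (X j @^-1` D).
Proof.
move=> iX ij mC mD.
have := iX [set i; j]%SET (fun k => if k == i then C else D).
rewrite big_setU1 ?inE//= big_set1 eqxx (eq_sym j) (negPf ij) => <-.
  congr (P _); apply/seteqP; split => w /=.
    by move=> [wi wj] k /=; rewrite !inE => /orP[]/eqP ->;
      rewrite ?eqxx // eq_sym (negPf ij).
  move=> h; split.
    by have := h i; rewrite /= eqxx; apply; rewrite !inE eqxx.
  by have := h j; rewrite /= eq_sym (negPf ij); apply; rewrite !inE eqxx orbT.
by move=> k _; case: ifP.
Qed.

Lemma measurable_RV_preimage disp' (U : measurableType disp')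
    (Y : {RV P >-> U}) (C : set U) : measurable C -> measurable (Y @^-1` C).
Proof. by move=> mC; rewrite -[X in measurable X]setTI; exact: measurable_funP. Qed.

(** Independence gives (1 - Q C)^n, and 1 - Q C <= 1 - q <= exp(-q). *)
Lemma iid_miss_bound disp' (U : measurableType disp') (Q : probability U R) n
    (X : 'I_n -> {RV P >-> U}) (C : set U) (q : R) :
  iid_sample Q X -> measurable C -> q%:E <= Q C ->
  P (\bigcap_(i in [set: 'I_n]) X i @^-1` (~` C)) <= (expR (- (n%:R * q)))%:E.
Proof.
move=> [iX dX] mC qC.
have QC : Q C = (fine (Q C))%:E by rewrite fineK// fin_num_measure.
have := iX [set: 'I_n]%SET (fun=> ~` C) (fun _ _ => measurableC mC).
rewrite (_ : [set` [set: 'I_n]%SET] = [set: 'I_n]); last first.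
  by apply/seteqP; split => i //= _; rewrite inE.
move=> ->; rewrite (eq_bigr (fun=> (1 - fine (Q C))%:E)); last first.
  move=> i _; have := dX i (~` C) (measurableC mC).
  by rewrite /distribution /pushforward => ->; rewrite probability_setC// QC.
rewrite -(big_morph EFin (@EFinM R) erefl) prodr_const cardsT card_ord lee_fin -mulrN expRM_natl.
have q1 : (0 <= 1 - fine (Q C))%R.
  by rewrite subr_ge0 -lee_fin -QC probability_le1.
rewrite lerXn2r ?nnegrE ?expR_ge0//.
apply: le_trans (expR_ge1Dx _).
by rewrite lerD2l lerN2 -lee_fin -QC.
Qed.

End union_bound.

(** * Probability estimates at a fixed scale *)

Section tails.
Context {R : realType} {d : nat} {disp : measure_display}
  {T : measurableType disp}.
Variables (P : probability T R) (Q : probability 'rV[R]_d R).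
Variables (Omega : set 'rV[R]_d) (B : R).
Hypothesis B0 : 0 < B.
Hypothesis Omega_bounded : forall x i, Omega x -> `|x ord0 i| <= B.

(** The integer part of L / rho, plus one, works: the extra 1 is at most 1 / rho because rho <=
    1. *)
Lemma mesh_count (L rho : R) : 0 <= L -> 0 < rho <= 1 ->
  exists m : nat, [/\ (0 < m)%N, L / m%:R <= rho & m%:R <= (L + 1) / rho].
Proof.
move=> L0 /andP[rho0 rho1]; exists (Num.truncn (L / rho)).+1.
have Lrho : 0 <= L / rho by rewrite divr_ge0// ltW.
split=> //; first by rewrite ler_pdivrMr// mulrC -ler_pdivrMr// ltW// truncnS_gt.
rewrite -natr1 mulrDl lerD ?truncn_le//.
by rewrite ler_pdivlMr// mul1r.
Qed.

Lemma uncovered_point_bound n (X : 'I_n -> {RV P >-> 'rV[R]_d}) (rho q : R)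
    (E : set T) :
  iid_sample Q X -> 0 < rho <= 1 ->
  (forall x, Omega x -> exists C, [/\ measurable C,
     C `<=` [set y | l2norm (x - y) <= rho] & (q%:E <= Q C)%E]) ->
  measurable E ->
  E `<=` [set w | exists2 x, Omega x & forall i, 2 * rho < l2norm (x - X i w)] ->
  (P E <= (((2 * d%:R * B + 1) / rho) ^+ d * expR (- (n%:R * q)))%:E)%E.
Proof.
move=> iidX rho01 Omega_low mE EX; have /andP[rho0 rho1] := rho01.
(* A cell of half-side [B / m] has Euclidean diameter at most [d * (2 * (B / m))], so this is the
   length to be divided into [m] parts. *)
have L0 : 0 <= 2 * d%:R * B by rewrite mulr_ge0// ltW.
have [m [m0 mrho mcount]] := mesh_count L0 rho01.
(* Each [F f] depends on the cell alone and not on the uncovered point, which makes the union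
   finite. A cell that misses [Omega] receives the empty event. *)
have /choice[F FP] : forall f : {ffun 'I_d -> 'I_m}, exists F : set T,
    [/\ measurable F, (P F <= (expR (- (n%:R * q)))%:E)%E &
     forall w x, Omega x -> cube (grid B f) (B / m%:R) x ->
       (forall i, 2 * rho < l2norm (x - X i w)) -> F w].
  move=> f; have [[x0 Ox0 fx0]|nx0] :=
    pselect (exists2 x0, Omega x0 & cube (grid B f) (B / m%:R) x0); last first.
    exists set0; split => //; first by rewrite measure0 lee_fin expR_ge0.
    by move=> w x Ox fx; case: nx0; exists x.
  have [C [mC Crho qC]] := Omega_low _ Ox0.
  exists (\bigcap_(i in [set: 'I_n]) X i @^-1` (~` C)); split.
  - apply: fin_bigcap_measurable => // i _.
    exact/measurable_RV_preimage/measurableC.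
  - exact: (iid_miss_bound iidX mC qC).
  - move=> w x Ox fx xX i _ /= /Crho /=; apply/negP; rewrite -ltNge.
    have xx0 : l2norm (x - x0) <= rho.
      rewrite (le_trans (cube_l2norm fx fx0))// (le_trans _ mrho)//.
      by rewrite le_eqVlt; apply/orP; left; apply/eqP; ring.
    have := xX i; rewrite -(subrKA x0) => /lt_le_trans/(_ (l2norm_triangle _ _)).
    lra.
apply: le_trans (@finite_union_bound _ _ _ P _ E F
  (expR (- (n%:R * q))) mE _ _ _) _.
- by move=> f; have [] := FP f.
- move=> w /EX[x Ox xX].
  have [f fx] := grid_cover m0 (fun i => Omega_bounded i Ox).
  by exists f => //; have [_ _ Ff] := FP f; exact: Ff Ox fx xX.
- by move=> f; have [] := FP f.
rewrite lee_fin card_ffun !card_ord natrX ler_wpM2r ?expR_ge0//.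
by rewrite lerXn2r ?nnegrE ?ler0n// divr_ge0 ?addr_ge0// ltW.
Qed.

Lemma close_pair_bound n (X : 'I_n -> {RV P >-> 'rV[R]_d}) (K s : R) (i j : 'I_n)
    (E : set T) :
  measurable Omega -> Q Omega = 1%E -> 0 <= K ->
  (forall A, measurable A -> (Q A <= K%:E * lebesgue_rV d A)%E) ->
  iid_sample Q X -> i != j -> 0 < s <= 1 -> measurable E ->
  E `<=` [set w | l2norm (X i w - X j w) < s] ->
  (P E <= (K ^+ 2 * (3 * (2 * B + 1)) ^+ d * s ^+ d)%:E)%E.
Proof.
move=> mO QO K0 QK [iX dX] ij s01 mE EX; have /andP[s0 s1] := s01.
(* Only the side 2 B / m of a cell matters here, so no factor [d] enters: side at most [s] for the
   cell, at most 3 s after enlarging its half-side by [s]. *)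
have L0 : 0 <= 2 * B by rewrite mulr_ge0// ltW.
have [m [m0 ms mcount]] := mesh_count L0 s01.
have Bm0 : 0 <= B / m%:R by rewrite divr_ge0// ltW.
have mXC k C : measurable C -> measurable (X k @^-1` C).
  exact: measurable_RV_preimage.
have Qcube c t u : 0 <= t -> 2 * t <= u -> (Q (cube c t) <= (K * u ^+ d)%:E)%E.
  move=> t0 tu; apply: le_trans (QK _ (measurable_cube _ _)) _.
  rewrite lebesgue_cube// -EFinM lee_fin ler_wpM2l// lerXn2r ?nnegrE//.
    by rewrite mulr_ge0.
  by rewrite (le_trans _ tu)// mulr_ge0.
(* The grid covers only the box around [Omega], so the null event that [X i] falls outside [Omega]
   is removed first. *)
pose N := X i @^-1` (~` Omega).
have mN : measurable N by apply: mXC; exact: measurableC.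
have PN : P N = 0%E.
  have := dX i _ (measurableC mO); rewrite /distribution /pushforward => ->.
  by rewrite probability_setC// QO subee.
pose F (f : {ffun 'I_d -> 'I_m}) := X i @^-1` cube (grid B f) (B / m%:R) `&`
  X j @^-1` cube (grid B f) (B / m%:R + s).
have mF f : measurable (F f).
  by apply: measurableI; apply: mXC; exact: measurable_cube.
have mEN : measurable (E `\` N) by exact: measurableD.
have PEN : (P E <= P (E `\` N))%E.
  rewrite -[leRHS]adde0 -PN.
  apply: (@le_trans _ _ (P (E `\` N `|` N))); last exact: measureU2.
  apply: le_measure; rewrite ?inE//; first exact: measurableU.
  by move=> w Ew; have [Nw|Nw] := pselect (N w); [right|left].
apply: (le_trans PEN).
apply: le_trans (@finite_union_bound _ _ _ P _ _ F
  (K * s ^+ d * (K * (3 * s) ^+ d)) mEN mF _ _) _.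
- move=> w [/EX /= ws /contrapT Ow].
  have [f fx] := grid_cover m0 (fun k => Omega_bounded k Ow).
  exists f => //; split => // k.
  have := fx k; have := le_lt_trans (normr_coord_le_l2norm _ k) ws.
  rewrite !mxE ltr_norml !ler_norml; lra.
- move=> f; rewrite mutually_independent2//; [|exact: measurable_cube..].
  have dXE k C : measurable C -> P (X k @^-1` C) = Q C.
    by move=> mC; rewrite -(dX k _ mC).
  rewrite !dXE; [|exact: measurable_cube..].
  rewrite EFinM lee_pmul//; first by apply: Qcube => //; lra.
  by apply: Qcube; lra.
rewrite lee_fin card_ffun !card_ord natrX.
rewrite (_ : K * _ * _ = K ^+ 2 * (3 * s ^+ 2) ^+ d); last first.
  by rewrite !exprMn; ring.
(* One of the two factors [s] in each dimension pays for the number of cells, since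
   [m * s <= 2 * B + 1]; the other one remains in the bound. *)
rewrite (_ : _ * (K ^+ 2 * _) = K ^+ 2 * (m%:R * (3 * s ^+ 2)) ^+ d); last first.
  by rewrite [in RHS]exprMn; ring.
rewrite -[leRHS]mulrA -exprMn ler_wpM2l ?sqr_ge0//.
rewrite lerXn2r ?nnegrE ?mulr_ge0 ?addr_ge0 ?sqr_ge0 ?(ltW s0)//.
have := mcount; rewrite ler_pdivlMr// => h.
rewrite (_ : m%:R * _ = 3 * s * (m%:R * s)); last by ring.
rewrite [leRHS](_ : _ = 3 * s * (2 * B + 1)); last by ring.
by rewrite ler_wpM2l// mulr_ge0// ltW.
Qed.

End tails.

(** * Fill distance and separation events, and their measurability *)

Section events.
Context {R : realType} {d : nat}.
Implicit Types (Omega : set 'rV[R]_d).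

Section fine_bigmin.
Variables (I : finType) (C : pred I) (F : I -> R) (i0 : I).
Hypothesis Ci0 : C i0.
Let v : \bar R := \big[mine/+oo%E]_(i | C i) (F i)%:E.

(** The witness [i0] excludes the value [+oo] of an empty minimum, which [fine] would turn into
    0. *)
Let v_fin : v = (fine v)%:E.
Proof.
rewrite fineK// fin_numElt; apply/andP; split.
  by apply/bigmin_gtP; split => // i _; rewrite ltNyr.
by apply/bigmin_ltP; right; exists i0 => //; rewrite ltry.
Qed.

Lemma fine_bigmin_gtP (t : R) :
  t < fine v <-> forall i, C i -> t < F i.
Proof.
rewrite -lte_fin -v_fin; split; first by move=> /bigmin_gtP[_ h] i /h.
by move=> h; apply/bigmin_gtP; split => [|i /h]; rewrite ?ltry.
Qed.

Lemma fine_bigmin_ltP (t : R) :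
  fine v < t <-> exists2 i, C i & F i < t.
Proof.
rewrite -lte_fin -v_fin; split.
  by move=> /bigmin_ltP[|[i Ci]]; [rewrite ltNge leey|rewrite lte_fin; exists i].
by move=> [i Ci Fit]; apply/bigmin_ltP; right; exists i.
Qed.

Lemma fine_bigmin_ge0 : (forall i, 0 <= F i) -> 0 <= fine v.
Proof.
move=> F0; apply: fine_ge0; apply/bigmin_geP; split; first by rewrite leey.
by move=> i _; rewrite lee_fin.
Qed.

End fine_bigmin.

(** A strict inequality passes between the supremum and a single point of [Omega] without the
    supremum being attained. Nonnegativity serves to remove the absolute value in [bigO_P]. *)
Lemma fill_distance_gtP Omega (B : R) n (X : 'I_n -> 'rV[R]_d) (t : R) :
  Omega !=set0 -> (forall x i, Omega x -> `|x ord0 i| <= B) -> (0 < n)%N ->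
  0 <= fill_distance Omega X /\
  (t < fill_distance Omega X <->
   exists2 x, Omega x & forall i, t < l2norm (x - X i)).
Proof.
case: n X => // n X [x0 Ox0] OB _.
pose v x := fine (\big[mine/+oo%E]_(i < n.+1) (l2norm (x - X i))%:E).
have S0 : [set v x | x in Omega] !=set0 by exists (v x0), x0.
(* The distance to the first sample bounds every minimum; without an upper bound [sup] would be a
   default value. *)
have Sub : has_ubound [set v x | x in Omega].
  exists (d%:R * B + l2norm (- X ord0)) => _ [x Ox <-].
  have xB : l2norm x <= d%:R * B by apply: l2norm_le_sup => i; exact: OB.
  apply: le_trans (lerD xB (lexx _)); apply: le_trans (l2norm_triangle _ _).
  rewrite leNgt; apply/negP => /(@fine_bigmin_gtP _ xpredT _ ord0 isT).
  by move=> /(_ ord0 isT); rewrite ltxx.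
split.
  apply: le_trans (ub_le_sup Sub _); last by exists x0.
  by apply: fine_bigmin_ge0 => i; exact: l2norm_ge0.
split.
  move=> /(sup_gt S0)[_ [x Ox <-] /(@fine_bigmin_gtP _ xpredT _ ord0 isT) tx].
  by exists x => // i; exact: tx.
move=> [x Ox tx]; apply: (@lt_le_trans _ _ (v x)).
  by apply/(@fine_bigmin_gtP _ xpredT _ ord0 isT) => i _; exact: tx.
by apply: (ub_le_sup Sub); exists x.
Qed.

Lemma separation_ltP n (X : 'I_n -> 'rV[R]_d) (t : R) : (1 < n)%N ->
  0 <= separation X /\
  (separation X < t <->
   exists2 p : 'I_n * 'I_n, (p.1 < p.2)%N & l2norm (X p.1 - X p.2) < t).
Proof.
case: n X => [//|[//|n]] X _; split.
  by apply: fine_bigmin_ge0 => p; exact: l2norm_ge0.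
exact: (@fine_bigmin_ltP _ (fun p : 'I_n.+2 * 'I_n.+2 => (p.1 < p.2)%N)
  (fun p => l2norm (X p.1 - X p.2)) (ord0, lift ord0 ord0)).
Qed.

Lemma rV_rat_dense (x : 'rV[R]_d) (e : R) : 0 < e ->
  exists q : 'rV[rat]_d, l2norm (x - map_mx ratr q) < e.
Proof.
(* Dividing by [d.+1] makes the final bound [d * s < e] strict and includes [d = 0]. *)
move=> e0; pose s := e / d.+1%:R; have s0 : 0 < s by rewrite divr_gt0.
have xq i : exists q : rat, ratr q \in `]x ord0 i - s, x ord0 i + s[.
  by have [|q qP] := @rat_in_itvoo R (x ord0 i - s) (x ord0 i + s);
    [lra|exists q].
have [q qP] := choice xq; exists (\row_i q i).
apply: (@le_lt_trans _ _ (d%:R * s)).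
  apply: l2norm_le_sup => i; rewrite !mxE; have := qP i.
  by rewrite in_itv/= => /andP[]; rewrite ler_norml; lra.
by rewrite mulrCA gtr_pMr// ltr_pdivrMr// mul1r ltr_nat.
Qed.

Variables (disp : measure_display) (T : measurableType disp) (P : probability T R).

Lemma measurable_l2norm_lt (Y Z : T -> 'rV[R]_d) (t : R) :
  measurable_fun setT Y -> measurable_fun setT Z ->
  measurable [set w | l2norm (Y w - Z w) < t].
Proof.
move=> mY mZ; have := measurable_fun_l2norm_sub mY mZ.
move=> /(_ measurableT `]-oo, t[%classic (measurable_itv _)); rewrite setTI.
by congr (measurable _); apply/seteqP; split => w /=; rewrite in_itv.
Qed.

Lemma measurable_l2norm_gt (Y Z : T -> 'rV[R]_d) (t : R) :
  measurable_fun setT Y -> measurable_fun setT Z ->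
  measurable [set w | t < l2norm (Y w - Z w)].
Proof.
move=> mY mZ; have := measurable_fun_l2norm_sub mY mZ.
move=> /(_ measurableT `]t, +oo[%classic (measurable_itv _)); rewrite setTI.
by congr (measurable _); apply/seteqP; split => w /=; rewrite in_itv/= andbT.
Qed.

(* Omega is arbitrary: the existential over its points is replaced by a
   countable union over the rational balls that meet it. *)
Lemma measurable_uncovered Omega n (X : 'I_n -> {RV P >-> 'rV[R]_d}) (t : R) :
  measurable [set w | exists2 x, Omega x & forall i, t < l2norm (x - X i w)].
Proof.
pose D := [set qk : 'rV[rat]_d * nat | exists2 x, Omega x &
  l2norm (x - map_mx ratr qk.1) < qk.2.+1%:R^-1].
rewrite [X in measurable X](_ : _ = \bigcup_(qk in D) \bigcap_(i in [set: 'I_n])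
   [set w | t + qk.2.+1%:R^-1 < l2norm (map_mx ratr qk.1 - X i w)]).
  rewrite bigcup_mkcond; apply: countable_bigcupT_measurable => // -[q k] /=.
  case: ifPn => // _; apply: fin_bigcap_measurable => // i _.
  exact: (@measurable_l2norm_gt (cst (map_mx ratr q)) (X i)).
apply/seteqP; split => w /=.
  move=> [x Ox xX].
  (* Finitely many strict inequalities leave a common slack [v]. A radius below v / 2 spends it
     twice: in moving from [x] to the rational centre, and in the margin that the event at this
     centre requires. *)
  have [v v0 vX] : exists2 v : R, 0 < v &
      forall i, v <= l2norm (x - X i w) - t.
    exists (\big[Num.min/1]_(i < n) (l2norm (x - X i w) - t)).
      by apply/bigmin_gtP; split => // i _; rewrite subr_gt0.
    by move=> i; exact: bigmin_le_cond.
  have [k kv] : exists k : nat, 2 * k.+1%:R^-1 < v.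
    exists (Num.truncn (2 / v)).
    by rewrite ltr_pdivrMr// mulrC -ltr_pdivrMr// truncnS_gt.
  have k0 : (0 : R) < k.+1%:R^-1 by rewrite invr_gt0.
  have [q xq] := rV_rat_dense x k0.
  exists (q, k) => /=; first by exists x.
  move=> i _ /=; have vi := vX i.
  have := l2norm_triangle (x - map_mx ratr q) (map_mx ratr q - X i w).
  move: (_^-1) k0 kv xq => kinv; rewrite subrKA; lra.
move=> [[p k] /= [x Ox xp] pX]; exists x => // i; move: xp (pX i I) => /=; move: (_^-1) => kinv.
have := l2norm_triangle (map_mx ratr p - x) (x - X i w).
rewrite subrKA (l2norm_distC _ x); lra.
Qed.

End events.

(** * Elementary estimates on roots, logarithms and thresholds *)

Section rates.
Context {R : realType}.

Lemma powR_invnK (a : R) (d : nat) : (0 < d)%N -> 0 <= a ->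
  (a `^ d%:R^-1) ^+ d = a.
Proof.
move=> d0 a0; rewrite -powR_mulrn ?powR_ge0// -powRrM mulVf ?powRr1//.
by rewrite pnatr_eq0 -lt0n.
Qed.

(** From ln x = 2 ln (sqrt x) and ln y <= y - 1. It turns the decay of ln n / n into an explicit
    threshold. *)
Lemma ln_le_sqrt (x : R) : 0 < x -> ln x <= 2 * Num.sqrt x.
Proof.
move=> x0; have s0 : 0 < Num.sqrt x by rewrite sqrtr_gt0.
rewrite -{1}(sqr_sqrtr (ltW x0)) lnXn// -[leLHS]mulr_natl ler_wpM2l//.
have := @le_ln1Dx R (Num.sqrt x - 1); rewrite (addrC 1) subrK; lra.
Qed.

Lemma ln_ge_half (x : R) : 2 <= x -> 2^-1 <= ln x.
Proof.
move=> x2; have x0 : 0 < x by lra.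
have xV : x^-1 <= 2^-1 by rewrite lef_pV2 ?posrE.
have xV0 : 0 < x^-1 by rewrite invr_gt0.
have := @le_ln1Dx R (x^-1 - 1); rewrite (addrC 1) subrK lnV ?posrE//; lra.
Qed.

Lemma nat_large (a b : R) : exists N : nat, (0 < N)%N /\
  forall n, (N < n)%N -> [/\ (1 < n)%N, a < n%:R & b < n%:R].
Proof.
exists (maxn 1 (maxn (Num.truncn a).+1 (Num.truncn b).+1)).
rewrite leq_max; split => // n; rewrite !gtn_max => /and3P[n1 an bn].
split => //; [apply: lt_trans (truncnS_gt a) _|apply: lt_trans (truncnS_gt b) _];
  by rewrite ltr_nat.
Qed.

End rates.

(** * The two rates in probability *)

Section rates_in_probability.
Context {R : realType} {d : nat} {disp : measure_display}
  {T : measurableType disp}.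
Variables (P : probability T R) (Q : probability 'rV[R]_d R).
Variables (Omega : set 'rV[R]_d) (B : R).
Hypothesis d_gt0 : (0 < d)%N.
Hypothesis B0 : 0 < B.
Hypothesis Omega_bounded : forall x i, Omega x -> `|x ord0 i| <= B.
Variable X : forall n : nat, 'I_n -> {RV P >-> 'rV[R]_d}.
Hypothesis X_iid : forall n : nat, iid_sample Q (X (n := n)).

(** The radius [rho = b * a] satisfies c rho^d = 2 ln n / n, so one cell contributes at most n^-2.
    The number of cells is at most G / rho^d = G c n / (2 ln n), and the total is O(1 / n). *)
Lemma fill_distance_rate (K : R) :
  Omega !=set0 -> interior_cone_condition Omega -> 0 < K ->
  (forall A, measurable A -> A `<=` Omega ->
    (K%:E * lebesgue_rV d A <= Q A)%E) ->
  bigO_P P (fun n w => fill_distance Omega (fun i : 'I_n => X i w))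
    (fun n => n%:R `^ (- d%:R^-1) * (ln n%:R) `^ (d%:R^-1)).
Proof.
move=> O0 Ocone K0 KQ e e0.
have [k [r [k0 r0 Ocube]]] := interior_cone_cube d_gt0 Ocone.
pose c := K * (2 * k) ^+ d; have c0 : 0 < c by rewrite mulr_gt0// exprn_gt0// mulr_gt0.
(* [rho <= r] is needed for the cube in the cone, [rho <= 1] for the cell count. *)
pose u := Num.min r 1; have u0 : 0 < u by rewrite lt_min r0 ltr01.
pose G := (2 * d%:R * B + 1) ^+ d.
have G0 : 0 < G by rewrite exprn_gt0// ltr_wpDl// !mulr_ge0// ltW.
pose b := (2 / c) `^ d%:R^-1.
have c2 : 0 < 2 / c by rewrite divr_gt0.
have b0 : 0 < b by rewrite powR_gt0.
(* The first threshold gives [rho <= u] through ln n <= 2 sqrt n; the second gives G c / n < e,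
   which is enough because 2 ln n >= 1. *)
have [N [N0 NP]] := nat_large ((4 / (c * u ^+ d)) ^+ 2) (G * c / e).
exists (2 * b), N; split => //; first by rewrite mulr_gt0.
move=> n /NP[n1 un Gn].
set a := n%:R `^ _ * _; pose rho := b * a.
have n0 : (0 : R) < n%:R by rewrite ltr0n (ltn_trans _ n1).
have lnn : 2^-1 <= ln n%:R :> R by rewrite ln_ge_half// ler_nat.
have ln0 : 0 < ln n%:R :> R by apply: lt_le_trans lnn.
have a0 : 0 < a by rewrite mulr_gt0 ?powR_gt0.
have rho0 : 0 < rho by rewrite mulr_gt0.
have rhoX : rho ^+ d = 2 / c * (ln n%:R / n%:R).
  rewrite !exprMn powRN exprVn !powR_invnK// ?ltW//; ring.
have rho_u : rho <= u.
  rewrite -(@ler_pXn2r _ d)// ?nnegrE ?(ltW rho0) ?(ltW u0)// rhoX.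
  have sn0 : 0 < Num.sqrt n%:R :> R by rewrite sqrtr_gt0.
  apply: (@le_trans _ _ (2 / c * (2 / Num.sqrt n%:R))).
    rewrite ler_wpM2l ?(ltW c2)// ler_pdivrMr//.
    rewrite -[X in _ / _ * X](sqr_sqrtr (ltW n0)) expr2 mulrA divfK ?gt_eqF//.
    exact: ln_le_sqrt.
  have cu : 0 < c * u ^+ d by rewrite mulr_gt0// exprn_gt0.
  have : 4 / (c * u ^+ d) <= Num.sqrt n%:R.
    rewrite -[leLHS]ger0_norm ?divr_ge0 ?(ltW cu)// -sqrtr_sqr.
    by rewrite ler_wsqrtr// ltW.
  rewrite ler_pdivrMr// => h.
  rewrite (_ : _ * _ = 4 / (c * Num.sqrt n%:R)); last first.
    by field; rewrite !gt_eqF.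
  rewrite (ler_pdivrMr _ _ (mulr_gt0 c0 sn0)).
  by rewrite (_ : _ * _ = Num.sqrt n%:R * (c * u ^+ d)) //; ring.
move: rho_u; rewrite le_min => /andP[rho_r rho_1].
pose E := [set w | exists2 x, Omega x & forall i, 2 * rho < l2norm (x - X (n := n) i w)].
have -> : [set w | `|fill_distance Omega (fun i : 'I_n => X i w) / a| > 2 * b] = E.
  apply/seteqP; split => w /=;
    have [h0 hP] := fill_distance_gtP (fun i : 'I_n => X i w) (2 * rho) O0
      Omega_bounded (ltn_trans (ltn0Sn 0) n1).
    by rewrite ger0_norm ?divr_ge0 ?(ltW a0)// ltr_pdivlMr// -mulrA => /hP.
  by move=> /hP; rewrite ger0_norm ?divr_ge0 ?(ltW a0)// ltr_pdivlMr// -mulrA.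
have mE : measurable E by exact: measurable_uncovered.
have rho01 : 0 < rho <= 1 by rewrite rho0.
apply: le_lt_trans (uncovered_point_bound (q := c * rho ^+ d) B0 Omega_bounded
  (X_iid n) rho01 _ mE (fun _ => id)) _.
  move=> x Ox; have [|z zO] := Ocube x rho Ox; first by rewrite rho0.
  exists (cube z (k * rho)); split; first exact: measurable_cube.
    by move=> y /zO[].
  apply: le_trans (KQ _ _ _); [|exact: measurable_cube|by move=> y /zO[]].
  rewrite lebesgue_cube ?(ltW (mulr_gt0 k0 rho0))// -EFinM lee_fin.
  by rewrite /c -mulrA -exprMn mulrA.
have -> : n%:R * (c * rho ^+ d) = ln (n%:R ^+ 2).
  rewrite rhoX lnXn// -mulr_natl; field; rewrite !gt_eqF//.
rewrite -lnV ?posrE ?exprn_gt0// lnK ?posrE ?invr_gt0 ?exprn_gt0//.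
rewrite lte_fin expr_div_n rhoX -/G.
rewrite (_ : _ * _ = G * c / (2 * ln n%:R) / n%:R); last first.
  by field; rewrite !gt_eqF.
move: Gn; rewrite ltr_pdivrMr// => Gn.
rewrite ltr_pdivrMr// [ltRHS]mulrC; apply: le_lt_trans Gn.
rewrite ler_pdivrMr ?mulr_gt0// ler_peMr ?(ltW (mulr_gt0 G0 c0))//; lra.
Qed.

(** At scale [s = m * b] with b^d = n^-2, each pair costs at most C m^d n^-2; the n^2 pairs together
    cost C m^d, whatever n is. *)
Lemma separation_rate (K : R) :
  measurable Omega -> Q Omega = 1%E -> 0 < K ->
  (forall A, measurable A -> (Q A <= K%:E * lebesgue_rV d A)%E) ->
  bigOmega_P P (fun n w => separation (fun i : 'I_n => X i w))
    (fun n => n%:R `^ (- (2 / d%:R))).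
Proof.
move=> mO QO K0 QK e e0.
pose C := K ^+ 2 * (3 * (2 * B + 1)) ^+ d.
have C0 : 0 < C.
  by rewrite mulr_gt0 ?exprn_gt0// mulr_gt0// ltr_wpDl// mulr_ge0// ltW.
(* The bound by 1 ensures both [s <= 1] and [m ^+ d <= m]; the other bound makes [C * m] at most
   [e / 2]. *)
pose m := Num.min 1 (e / (2 * C)).
have m0 : 0 < m by rewrite lt_min ltr01 divr_gt0// mulr_gt0.
exists m, 1%N; split => // n n1; set b := n%:R `^ _.
have n0 : (0 : R) < n%:R by rewrite ltr0n (ltn_trans _ n1).
have b0 : 0 < b by rewrite powR_gt0.
have bX : b ^+ d = (n%:R ^+ 2)^-1.
  rewrite /b powRN powRrM exprVn powR_invnK ?powR_ge0//.
  by rewrite powR_mulrn ?ltW.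
pose s := m * b.
have b1 : b <= 1.
  rewrite -(@ler_pXn2r _ d)// ?nnegrE ?(ltW b0)// bX expr1n invf_le1 ?exprn_gt0//.
  by rewrite exprn_ege1// ler1n (ltn_trans _ n1).
have s01 : 0 < s <= 1.
  rewrite mulr_gt0//= (le_trans _ b1)// ler_piMl ?(ltW b0)//.
  by rewrite ge_min lexx.
(* Empty events at the pairs that are not increasing let the union run over the whole product type,
   of cardinality n^2. *)
pose A (p : 'I_n * 'I_n) := if (p.1 < p.2)%N
  then [set w | l2norm (X p.1 w - X p.2 w) < s] else set0.
have mA p : measurable (A p).
  by rewrite /A; case: ifP => // _; exact: measurable_l2norm_lt.
pose E := \bigcup_p A p.
have -> : [set w | `|separation (fun i : 'I_n => X i w) / b| < m] = E.
  apply/seteqP; split => w /=;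
    have [h0 hP] := separation_ltP (fun i : 'I_n => X i w) s n1.
    rewrite ger0_norm ?divr_ge0 ?(ltW b0)// ltr_pdivrMr// => /hP[p pp ps].
    by exists p => //; rewrite /A pp.
  move=> [p _]; rewrite /A; case: ifP => // pp ps.
  by rewrite ger0_norm ?divr_ge0 ?(ltW b0)// ltr_pdivrMr//; apply/hP; exists p.
have mE : measurable E by exact: fin_bigcup_measurable.
apply: le_lt_trans (finite_union_bound (P := P) (b := C * s ^+ d) mE mA _ _) _.
- by [].
- move=> p; have := mA p; rewrite /A; case: ifP => [pp mAp|_ _]; last first.
    rewrite measure0 lee_fin mulr_ge0 ?exprn_ge0 ?(ltW C0)//.
    by case/andP: s01 => /ltW.
  apply: (close_pair_bound (i := p.1) (j := p.2) B0 Omega_bounded mO QO (ltW K0)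
    QK (X_iid n) _ s01 mAp).
    by rewrite -val_eqE /= neq_ltn pp.
  by [].
rewrite lte_fin card_prod !card_ord exprMn bX natrM.
rewrite (_ : _ * _ = C * m ^+ d); last by field; rewrite gt_eqF.
have md : m ^+ d <= m.
  by rewrite -[leRHS]expr1 ler_wiXn2l ?(ltW m0)// ge_min lexx.
apply: (@le_lt_trans _ _ (C * m)); first by rewrite ler_wpM2l ?(ltW C0).
apply: (@le_lt_trans _ _ (C * (e / (2 * C)))).
  by rewrite ler_wpM2l ?(ltW C0)// ge_min lexx orbT.
rewrite (_ : _ * _ = e / 2); last by field; rewrite gt_eqF.
lra.
Qed.

End rates_in_probability.

Theorem theorem1 (R : realType) (d : nat) (d_gt0 : (0 < d)%N)
    (Omega : set 'rV[R]_d) (Omega_compact : compact Omega)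
    (Omega_cone : interior_cone_condition Omega)
    (Q : probability 'rV[R]_d R) (Q_nice : nicely_behaving Omega Q)
    (disp : measure_display) (T : measurableType disp) (P : probability T R)
    (X : forall n : nat, 'I_n -> {RV P >-> 'rV[R]_d})
    (X_iid : forall n : nat, iid_sample Q (X n)) :
  bigO_P P (fun n w => fill_distance Omega (fun i : 'I_n => X n i w))
    (fun n => n%:R `^ (- d%:R^-1) * (ln n%:R) `^ (d%:R^-1)) /\
  bigOmega_P P (fun n w => separation (fun i : 'I_n => X n i w))
    (fun n => n%:R `^ (- (2 / d%:R))).
Proof.
have mO := compact_measurable_rV Omega_compact.
have [B B0 OB] := compact_coord_bounded Omega_compact.
have [K [K' [K0 K'0 KQ QK']]] := nicely_behaving_lebesgue mO Q_nice.
have [QO _ _] := Q_nice.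
(* Total mass 1 excludes the empty domain, over which the supremum would be a default value. *)
have O0 : Omega !=set0.
  apply/set0P/eqP => O0; move: QO; rewrite O0 measure0 => /eqP.
  by rewrite eqe eq_sym oner_eq0.
split; first exact: (fill_distance_rate d_gt0 B0 OB X_iid O0 Omega_cone K0 KQ).
exact: (separation_rate d_gt0 B0 OB X_iid mO QO K'0 QK').
Qed.
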